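(* Let $X$ be a uniformly smooth complex Banach space with modulus of smoothness $\rho(u)$, let $s(u):=\rho(u)/u$ for $u>0$, $s(0):=0$, and let $s^{-1}$ be the inverse function of $s$. Let $\mathcal{D}$ be a dictionary in $X$. Assume that a sequence $\tau=\{t_k\}_{k=1}^\infty$, $t_k\in[0,1]$, satisfies the following condition: for any $\theta>0$, $$\sum_{m=1}^\infty t_m\, s^{-1}(\theta t_m)=\infty .$$ Then, for any $f\in X$, the residuals $f_m$ of the Weak Greedy Algorithm with Free Relaxation (WGAFR) with weakness sequence $\tau$, applied to $f$ with respect to $\mathcal{D}$ (for any realization of the algorithm), satisfy $$\lim_{m\to\infty}\|f_m\|=0 .$$
   Context: A dictionary in a Banach space $X$ is a set $\mathcal{D}\subset X$ such that $\|g\|\le 1$ for each $g\in\mathcal{D}$ and the closure of $\operatorname{span}\mathcal{D}$ is $X$. For a bounded linear functional $F\in X^*$ put $\|F\|_{\mathcal{D}}:=\sup_{g\in\mathcal{D}}|F(g)|$. For nonzero $h\in X$, $F_h$ denotes a norming functional of $h$: $F_h\in X^*$, $\|F_h\|=1$, $F_h(h)=\|h\|$. The modulus of smoothness of $X$ is $\rho(u):=\sup_{\|x\|=\|y\|=1}\left(\frac12(\|x+uy\|+\|x-uy\|)-1\right)$ for real $u$; $X$ is uniformly smooth if $\lim_{u\to0}\rho(u)/u=0$. For a uniformly smooth complex Banach space, $s$ is a continuous increasing function on $[0,\infty)$ with $s(0)=0$, so it has an inverse defined on its range, which is contained in $[0,1]$. Convention: $s^{-1}(y):=+\infty$ if $y\ge0$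 is not in the range of $s$ (then the series in the condition is regarded as divergent to $\infty$ if such a term with $t_m>0$ occurs). WGAFR with weakness sequence $\tau=\{t_m\}_{m=1}^\infty$, $t_m\in[0,1]$: set $f_0:=f$, $G_0:=0$. For each $m\ge1$: (1) $\varphi_m\in\mathcal{D}$ is any element satisfying $|F_{f_{m-1}}(\varphi_m)|\ge t_m\|F_{f_{m-1}}\|_{\mathcal{D}}$ (if $f_{m-1}=0$, $\varphi_m\in\mathcal{D}$ is arbitrary). (2) Find $w_m,\lambda_m\in\mathbb{C}$ such that $\|f-((1-w_m)G_{m-1}+\lambda_m\varphi_m)\|=\inf_{\lambda,w\in\mathbb{C}}\|f-((1-w)G_{m-1}+\lambda\varphi_m)\|$ and define $G_m:=(1-w_m)G_{m-1}+\lambda_m\varphi_m$. (3) $f_m:=f-G_m$. A realization is any sequence of choices consistent with (1)–(3). *)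

(* Defs.v *)
From HB Require Import structures.
From mathcomp Require Import all_boot all_order all_algebra.
From mathcomp Require Import all_classical all_reals all_analysis.
From mathcomp Require Import complex.

Set Implicit Arguments.
Unset Strict Implicit.
Unset Printing Implicit Defensive.

Import Order.TTheory GRing.Theory Num.Theory.
Import numFieldNormedType.Exports.

Local Open Scope classical_set_scope.
Local Open Scope ring_scope.
Local Open Scope complex_scope.

(* In a normed module over R[i] (in particular in R[i] itself) the norm `|x|
   is an element of R[i] with zero imaginary part; rnorm is that same norm
   read as a real number. *)
Definition rnorm (R : realType) (V : normedModType R[i]) (x : V) : R :=
  complex.Re `|x|.

Section smoothness.
Variables (R : realType) (X : normedModType R[i]).

Definition modulus_of_smoothness (u : R) : R :=
  sup [set r | exists x y : X, [/\ rnorm x = 1, rnorm y = 1 &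
    r = (rnorm (x + u%:C *: y) + rnorm (x - u%:C *: y)) / 2 - 1]].

Definition uniformly_smooth : Prop :=
  (fun u => modulus_of_smoothness u / u) @ (0 : R)^' --> (0 : R).

Definition smooth_s (u : R) : R :=
  if u == 0 then 0 else modulus_of_smoothness u / u.

(* The inverse of smooth_s as a function on [0, +oo[, extended by +oo outside
   the range. *)
Definition smooth_s_inv (y : R) : \bar R :=
  if y \in smooth_s @` `[0, +oo[
  then ('pinv_(fun=> 0) `[0, +oo[ smooth_s y)%:E else +oo%E.

End smoothness.

Section algorithm.
Variables (R : realType) (X : normedModType R[i]).
Implicit Types (D : set X) (F : {linear X -> R[i]^o}).

Definition lin_span D : set X :=
  [set x | exists (n : nat) (c : 'I_n -> R[i]) (g : 'I_n -> X),
    (forall i, D (g i)) /\ x = \sum_(i < n) c i *: g i].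

Definition dictionary D : Prop :=
  (forall g, D g -> rnorm g <= 1) /\ closure (lin_span D) = setT.

(* Real sup is 0 by default on unbounded sets; these two are only used for
   continuous F and D inside the unit ball, where the sets are bounded. *)
Definition dual_norm F : R := sup [set rnorm (F x) | x in [set x | rnorm x <= 1]].

Definition dict_norm D F : R := sup [set rnorm (F g) | g in D].

Definition norming F (h : X) : Prop :=
  [/\ continuous F, dual_norm F = 1 & F h = `|h|].

(* The residuals are f_m = f - G m.  Index m of phi, w and lam is used only
   for m >= 1; t is likewise the sequence t_1, t_2, ... *)
Definition WGAFR_realization (t : nat -> R) D (f : X) (phi : nat -> X)
    (w lam : nat -> R[i]) (G : nat -> X) : Prop :=
  G 0%N = 0 /\
  forall m, (0 < m)%N ->
    [/\ D (phi m),
        f - G m.-1 != 0 -> exists F : {linear X -> R[i]^o},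
          norming F (f - G m.-1) /\ t m * dict_norm D F <= rnorm (F (phi m)),
        rnorm (f - ((1 - w m) *: G m.-1 + lam m *: phi m)) =
          inf [set r | exists l v : R[i],
            r = rnorm (f - ((1 - v) *: G m.-1 + l *: phi m))] &
        G m = (1 - w m) *: G m.-1 + lam m *: phi m].

End algorithm.

(* Main.v *)
Require Import Defs.
From HB Require Import structures.
From mathcomp Require Import all_boot all_order all_algebra.
From mathcomp Require Import all_classical all_reals all_analysis.
From mathcomp Require Import complex.
From mathcomp Require Import ring lra.

Set Implicit Arguments.
Unset Strict Implicit.
Unset Printing Implicit Defensive.

Import Order.TTheory GRing.Theory Num.Theory.
Import numFieldNormedType.Exports.

Local Open Scope classical_set_scope.
Local Open Scope ring_scope.
Local Open Scope complex_scope.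

(** Suppose the residual norms, which never increase, stay above some [a > 0].
    Let [F] norm the residual [f_m = f - G_m].  Since [G_m] is a best
    approximation to [f] from a subspace containing the line through [G_m],
    the function [l |-> |f_m + l G_m|] is minimal at [0], and smoothness forces
    [F (G_m) = 0] ([norming_residual_approximant]).  Hence
    [|F f| = |F f_m| = |f_m| >= a].  Approximating [f] once and for all within
    [a / 2] by a finite combination of dictionary elements then bounds
    [dict_norm D F] below by some [b > 0] independent of [m]
    ([dict_norm_lower]), so the selected [phi_(m+1)] satisfies
    [|F phi_(m+1)| >= t_(m+1) b].

    Moving from a point [x] normed by [F] in direction [y] with step length [r]
    and the best phase decreases the norm by [r |F y|], up to an error
    [2 |x| rho (r |y| / |x|)] ([norming_descent]).  With [y = phi_(m+1)] and
    [r = a v], the error is at most [2 a v s(v)] because [rho] is convex and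
    vanishes at [0].  Choosing [v] with [s v = b t_(m+1) / 4] makes this half of
    the gain, so the norm drops by at least [(a b / 2) t_(m+1) v]
    ([WGAFR_step]).  Such a move leaves [G_m] unscaled, so it is one of the
    competitors in the minimization defining [G_(m+1)].

    Summing over [m], the series of [t_m s^-1(b t_m / 4)] is bounded, against
    the divergence assumption.  This needs [b t_m / 4] to lie in the range of
    [s]: that range contains [[0, 1/2]] by the intermediate value theorem
    ([smooth_s_range]), so shrinking [b] to at most [2] suffices. *)

(** * The norm read as a real number *)

Section RealNorm.
Variables (R : realType) (V : normedModType R[i]).
Implicit Types x y : V.

Lemma rnormE x : (rnorm x)%:C = `|x|.
Proof. by rewrite /rnorm RRe_real// ger0_real. Qed.

Lemma rnorm_ge0 x : 0 <= rnorm x.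
Proof. by rewrite -lecR rnormE normr_ge0. Qed.

Lemma rnorm0 : rnorm (0 : V) = 0.
Proof. by rewrite /rnorm normr0. Qed.

Lemma rnorm_eq0 x : (rnorm x == 0) = (x == 0).
Proof.
by rewrite -[RHS]normr_eq0 -rnormE -[0 in RHS](rmorph0 (real_complex R)) (inj_eq (@complexI R)).
Qed.

Lemma rnorm_gt0 x : (0 < rnorm x) = (x != 0).
Proof. by rewrite lt_def rnorm_ge0 andbT rnorm_eq0. Qed.

Lemma ler_rnormD x y : rnorm (x + y) <= rnorm x + rnorm y.
Proof. by rewrite -lecR rmorphD/= !rnormE ler_normD. Qed.

Lemma rnormN x : rnorm (- x) = rnorm x.
Proof. by rewrite /rnorm normrN. Qed.

Lemma rnormZ (a : R[i]) x : rnorm (a *: x) = rnorm (a : R[i]^o) * rnorm x.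
Proof. by apply: (@complexI R); rewrite rmorphM/= !rnormE normrZ. Qed.

Lemma rnorm_real (r : R) : rnorm (r%:C : R[i]^o) = `|r|.
Proof. by rewrite /rnorm normc_def/= expr0n/= addr0 sqrtr_sqr. Qed.

Lemma rnormZr (r : R) x : rnorm (r%:C *: x) = `|r| * rnorm x.
Proof. by rewrite rnormZ rnorm_real. Qed.

Lemma rnorm_sum n (g : 'I_n -> V) : rnorm (\sum_i g i) <= \sum_i rnorm (g i).
Proof.
elim/big_ind2 : _ => [|x r y s xr ys|//]; first by rewrite rnorm0.
by rewrite (le_trans (ler_rnormD _ _))// lerD.
Qed.

Lemma rnorm_normalize x : x != 0 -> rnorm ((rnorm x)^-1%:C *: x) = 1.
Proof.
move=> x0; rewrite rnormZr ger0_norm ?invr_ge0 ?rnorm_ge0//.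
by rewrite mulVf// rnorm_eq0.
Qed.

End RealNorm.

Lemma Re_le_rnorm (R : realType) (z : R[i]) : complex.Re z <= rnorm (z : R[i]^o).
Proof.
by rewrite -lecR rnormE (le_trans _ (normc_ge_Re z))// lecR ler_norm.
Qed.

Lemma ReD (R : realType) (a b : R[i]) :
  complex.Re (a + b) = complex.Re a + complex.Re b.
Proof. by case: a b => [? ?] []. Qed.

(** The phase makes it possible to replace [Re (F y)] by [|F y|] when choosing
    a complex step along [y]. *)
Lemma ex_phase (R : realType) (z : R[i]) :
  exists2 c : R[i], rnorm (c : R[i]^o) = 1 & c * z = (rnorm (z : R[i]^o))%:C.
Proof.
have [->|z0] := eqVneq z 0.
  by exists 1; rewrite ?mulr0 ?rnorm0// /rnorm normr1.
exists (z^-1 * `|z|); last by rewrite mulrC rnormE mulrA divff// mul1r.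
by rewrite /rnorm normrM normfV normr_id mulVf// normr_eq0.
Qed.

(** * The modulus of smoothness *)

Section Modulus.
Variables (R : realType) (X : normedModType R[i]).
(* On the zero space the modulus is the supremum of the empty set. *)
Hypothesis ntX : exists e : X, e != 0.
Implicit Types (x y : X) (u v : R).
Local Notation rho := (modulus_of_smoothness X).
Local Notation s := (smooth_s X).

Let ex_unit : exists e : X, rnorm e = 1.
Proof.
have [e e0] := ntX; exists ((rnorm e)^-1%:C *: e); exact: rnorm_normalize.
Qed.

Lemma modulus_ge u x y : rnorm x = 1 -> rnorm y = 1 ->
  (rnorm (x + u%:C *: y) + rnorm (x - u%:C *: y)) / 2 - 1 <= rho u.
Proof.
move=> x1 y1; apply: ub_le_sup; last by exists x, y.
exists `|u| => _ [a [b [a1 b1 ->]]].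
have := ler_rnormD a (u%:C *: b); have := ler_rnormD a (- (u%:C *: b)).
rewrite rnormN rnormZr a1 b1; lra.
Qed.

Lemma modulus_le u (b : R) : (forall x y, rnorm x = 1 -> rnorm y = 1 ->
  (rnorm (x + u%:C *: y) + rnorm (x - u%:C *: y)) / 2 - 1 <= b) -> rho u <= b.
Proof.
move=> h; apply: ge_sup; last by move=> _ [x [y [? ? ->]]]; exact: h.
by have [e e1] := ex_unit; eexists; exists e, e.
Qed.

Lemma modulus_ge0 u : 0 <= rho u.
Proof.
have [e e1] := ex_unit; apply: le_trans (modulus_ge u e1 e1).
have := ler_rnormD (e + u%:C *: e) (e - u%:C *: e).
rewrite addrACA subrr addr0 -mulr2n -scaler_nat.
have -> : (2%:R : R[i]) = (2%:R : R)%:C by rewrite rmorph_nat.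
rewrite rnormZr e1 ger0_norm//; lra.
Qed.

(** Convexity of the modulus between [0], where it vanishes, and [v]; each
    function [u |-> |x + u y|] is convex. *)
Lemma modulus_convex0 u v : 0 <= u -> u <= v -> 0 < v ->
  rho u <= u / v * rho v.
Proof.
move=> u0 uv v0; apply: modulus_le => x y x1 y1; have := modulus_ge v x1 y1.
set c := u / v.
have c0 : 0 <= c by rewrite divr_ge0// ltW.
have c1 : 0 <= 1 - c by rewrite subr_ge0 ler_pdivrMr ?mul1r.
have H (w : X) : rnorm (x + u%:C *: w) <= (1 - c) + c * rnorm (x + v%:C *: w).
  have -> : x + u%:C *: w = (1 - c)%:C *: x + c%:C *: (x + v%:C *: w).
    rewrite scalerDr scalerA -rmorphM/= /c divfK ?gt_eqF// addrA -scalerDl.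
    by rewrite -rmorphD/= subrK scale1r.
  by rewrite (le_trans (ler_rnormD _ _))// !rnormZr !ger0_norm// x1 mulr1.
have := H y; have := H (- y); rewrite !scalerN.
move=> h1 h2 /(ler_wpM2l c0) h3; lra.
Qed.

Lemma modulus_lipschitz u v : rho u <= rho v + `|u - v|.
Proof.
apply: modulus_le => x y x1 y1; have := modulus_ge v x1 y1.
have H (w : X) :
    rnorm (x + u%:C *: w) <= rnorm (x + v%:C *: w) + `|u - v| * rnorm w.
  rewrite -rnormZr -[u in leLHS](subrK v) rmorphD/= scalerDl addrCA addrC.
  exact: ler_rnormD.
have := H y; have := H (- y); rewrite !scalerN rnormN y1 mulr1; lra.
Qed.

Lemma continuous_modulus : continuous rho.
Proof.
move=> u; apply/cvgrPdist_le => e e0; near=> v.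
have uv : `|u - v| <= e by near: v; exact: cvgr_dist_le.
have := modulus_lipschitz u v; have := modulus_lipschitz v u.
rewrite (distrC v u) => h1 h2; rewrite ler_norml; apply/andP; split; lra.
Unshelve. all: by end_near. Qed.

(** The homogeneous form of the definition of the modulus. *)
Lemma modulus_norm_sum x y : x != 0 ->
  rnorm (x + y) + rnorm (x - y) <= 2 * rnorm x * (1 + rho (rnorm y / rnorm x)).
Proof.
move=> x0; have nx := x0; rewrite -rnorm_gt0 in nx.
have [->|y0] := eqVneq y 0.
  rewrite subr0 addr0 rnorm0 mul0r mulrDr mulr1.
  have := mulr_ge0 (ltW nx) (modulus_ge0 0); lra.
set u := rnorm y / rnorm x.
have := modulus_ge u (rnorm_normalize x0) (rnorm_normalize y0).
rewrite scalerA -rmorphM/= /u mulrAC divff ?rnorm_eq0// mul1r -/u.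
rewrite -scalerDr -scalerBr !rnormZr.
rewrite ger0_norm ?invr_ge0 ?rnorm_ge0//.
rewrite -mulrDr lerBlDr ler_pdivrMr// mulrC ler_pdivrMr// => h.
by rewrite (le_trans h)//; lra.
Qed.

Lemma smooth_s_gt0E u : 0 < u -> s u = rho u / u.
Proof. by move=> u0; rewrite /smooth_s gt_eqF. Qed.

(** Already the pairs with [y = x] give [rho u >= u - 1]; the point [2] is
    convenient, any [u > 1] would show that the range of [s] is nontrivial. *)
Lemma smooth_s2 : 1/2 <= s 2.
Proof.
rewrite smooth_s_gt0E// ler_pdivlMr// divfK//.
have [e e1] := ex_unit; apply: le_trans (modulus_ge 2 e1 e1).
have := ler_rnormD (e + 2%:C *: e) (- (e - 2%:C *: e)).
have -> : (e + 2%:C *: e) - (e - 2%:C *: e) = 4%:C *: e.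
  rewrite opprB [e + _]addrC addrACA subrr addr0 -scalerDl -rmorphD/=.
  by congr (_ %:C *: e); lra.
rewrite rnormN rnormZr e1 ger0_norm//; lra.
Qed.

Hypothesis smX : uniformly_smooth X.

Lemma continuous_smooth_s : continuous s.
Proof.
move=> u; have [->|u0] := eqVneq u 0.
  apply/continuous_withinNx; rewrite {2}/smooth_s eqxx.
  apply: cvg_trans smX; apply: near_eq_cvg; near=> v.
  by rewrite /smooth_s ifF//; apply/negbTE; near: v; exact: nbhs_dnbhs_neq.
rewrite /continuous_at {2}/smooth_s (negbTE u0).
have h : rho v / v @[v --> u] --> rho u / u.
  by apply: cvgM; [exact: continuous_modulus|exact: cvgV].
apply: cvg_trans h; apply: near_eq_cvg; near=> v.
rewrite /smooth_s ifF//; apply/negbTE; near: v.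
exact: (open_neq u0).
Unshelve. all: end_near. Qed.

Lemma smooth_s_small (e : R) : 0 < e -> exists2 v : R, 0 < v & s v < e.
Proof.
move=> e0; have /cvgrPdist_lt/(_ e e0) := @continuous_smooth_s 0.
rewrite /smooth_s eqxx -/s => /nbhs_ballP[d /= d0 h].
exists (d / 2); first by rewrite divr_gt0.
have /h : ball 0 d (d / 2).
  by rewrite -ball_normE/= sub0r normrN gtr0_norm ?divr_gt0// gtr_pMr// invf_lt1// ltr1n.
by rewrite /= sub0r normrN; apply: le_lt_trans; rewrite ler_norm.
Qed.

(** [s] is continuous with [s 0 = 0] and [s 2 >= 1/2], so every small enough
    value is attained and its inverse is finite. *)
Lemma smooth_s_range (r : R) : 0 <= r <= 1/2 -> (s @` `[0, +oo[) r.
Proof.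
move=> /andP[y0 y1]; have s0 : s 0 = 0 by rewrite /smooth_s eqxx.
have s2 := smooth_s2.
have [||u u02 <-] := @IVT _ s 0 2 r (ler0n _ _).
- by apply: continuous_subspaceT; exact: continuous_smooth_s.
- rewrite s0 min_l ?max_r; lra.
- by exists u => //=; move: u02; rewrite !in_itv/= andbT => /andP[].
Qed.

Lemma smooth_s_invE (r : R) : 0 <= r <= 1/2 ->
  exists2 v : R, smooth_s_inv X r = v%:E & 0 <= v /\ s v = r.
Proof.
move=> /smooth_s_range ys; rewrite /smooth_s_inv mem_set//.
eexists; first reflexivity; split; last by rewrite pinvK ?mem_set.
have /(_ ('pinv_(fun=> 0) `[0, +oo[ s r)) := @surjpinv_image_sub _ _ (fun=> 0)
  `[0, +oo[ (s @` `[0, +oo[) s (fun _ h => h).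
by rewrite /= in_itv/= andbT; apply; exists r.
Qed.

End Modulus.

(** * Norming functionals and descent *)

Section Norming.
Variables (R : realType) (X : normedModType R[i]).
Implicit Types (F : {linear X -> R[i]^o}) (x y : X).
Local Notation rho := (modulus_of_smoothness X).

(** If the values of [F] on the unit ball were unbounded, their [sup] would take
    the default value [0], which is not [dual_norm F = 1]. *)
Lemma norming_le F x y : norming F x -> rnorm (F y) <= rnorm y.
Proof.
move=> [_ F1 _]; have [->|y0] := eqVneq y 0; first by rewrite linear0 !rnorm0.
have [hs|/sup_out h] :=
    pselect (has_sup [set rnorm (F x) | x in [set x | rnorm x <= 1]]); last first.
  by move: F1; rewrite /dual_norm h => /eqP; rewrite eq_sym oner_eq0.
have : rnorm (F ((rnorm y)^-1%:C *: y)) <= dual_norm F.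
  apply: ub_le_sup hs.2 _ _; eexists; last reflexivity.
  by rewrite /= rnorm_normalize.
rewrite F1 linearZ/= rnormZr ger0_norm ?invr_ge0 ?rnorm_ge0// mulrC.
by rewrite ler_pdivrMr ?mul1r// rnorm_gt0.
Qed.

(** The modulus bounds [|x + l y| + |x - l y|] above, while
    [|x - l y| >= Re (F (x - l y)) = |x| + r |F y|] for the [l] of modulus [r]
    and suitable phase; the difference bounds [|x + l y|]. *)
Lemma norming_descent F x y (r : R) : norming F x -> x != 0 -> 0 <= r ->
  exists l : R[i], rnorm (x + l *: y) <=
    rnorm x - r * rnorm (F y) + 2 * rnorm x * rho (r * rnorm y / rnorm x).
Proof.
move=> Fx x0 r0; have [c c1 cF] := ex_phase (F y).
exists (- (r%:C * c)); rewrite scaleNr -scalerA.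
set z := r%:C *: (c *: y).
have nz : rnorm z = r * rnorm y by rewrite rnormZr rnormZ c1 mul1r ger0_norm.
have Fz : complex.Re (F (x + z)) = rnorm x + r * rnorm (F y).
  have [_ _ FE] := Fx.
  by rewrite linearD FE !linearZ/= ReD -[_ *: _]/(r%:C * (c * F y)) cF -rmorphM.
have := modulus_norm_sum (ex_intro _ x x0) z x0; rewrite nz.
have := le_trans (Re_le_rnorm _) (norming_le (x + z) Fx).
by rewrite Fz; move: (rho _) => q; lra.
Qed.

(** If [F y] were nonzero, the gain [r |F y|] in [norming_descent] would be
    linear in [r] and the error [o(r)], so a small step would decrease the norm. *)
Lemma norming_orthogonal F x y : uniformly_smooth X -> norming F x -> x != 0 ->
  (forall l : R[i], rnorm x <= rnorm (x + l *: y)) -> F y = 0.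
Proof.
move=> smX Fx x0 xmin; apply/eqP; rewrite -rnorm_eq0; apply/negPn/negP => Fy0.
have ntX : exists e : X, e != 0 by exists x.
have nx : 0 < rnorm x by rewrite rnorm_gt0.
have a0 : 0 < rnorm (F y) by rewrite lt_def Fy0 rnorm_ge0.
have ny : 0 < rnorm y by rewrite (lt_le_trans a0)// (norming_le _ Fx).
have [v v0 sv] := smooth_s_small ntX smX (divr_gt0 a0 (mulr_gt0 (ltr0n _ 2) ny)).
(* This step length turns the argument of [rho] into [v]. *)
have r0 : 0 <= v * rnorm x / rnorm y by rewrite divr_ge0 ?mulr_ge0 ?rnorm_ge0// ltW.
have [l] := norming_descent y Fx x0 r0.
move: sv; rewrite smooth_s_gt0E// divfK ?gt_eqF// mulfK ?gt_eqF//.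
rewrite ltr_pdivrMr// => rv; have := xmin l.
suff : 2 * rnorm x * rho v < v * rnorm x / rnorm y * rnorm (F y) by lra.
have -> : v * rnorm x / rnorm y * rnorm (F y) =
    2 * rnorm x * (rnorm (F y) / (2 * rnorm y) * v) by field; rewrite gt_eqF.
by rewrite ltr_pM2l// mulr_gt0.
Qed.

End Norming.

(** * The algorithm *)

Section Algorithm.
Variables (R : realType) (X : normedModType R[i]).
Variables (D : set X) (t : nat -> R) (f : X) (phi : nat -> X).
Variables (w lam : nat -> R[i]) (G : nat -> X).
Hypotheses (smX : uniformly_smooth X) (dictD : dictionary D).
Hypothesis realG : WGAFR_realization t D f phi w lam G.
Implicit Types (F : {linear X -> R[i]^o}).
Local Notation rho := (modulus_of_smoothness X).

Lemma WGAFR_best m (l v : R[i]) :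
  rnorm (f - G m.+1) <= rnorm (f - ((1 - v) *: G m + l *: phi m.+1)).
Proof.
have [_ /(_ m.+1 isT)[_ _ e ->]] := realG; rewrite e.
apply: ge_inf; last by exists l, v.
by exists 0 => _ [? [? ->]]; exact: rnorm_ge0.
Qed.

Lemma WGAFR_residual_le m : rnorm (f - G m.+1) <= rnorm (f - G m).
Proof. by have := WGAFR_best m 0 0; rewrite subr0 scale1r scale0r addr0. Qed.

(** Moving the residual along [G_m] amounts to rescaling [G_m]: this changes only
    the coefficients of [G_(m-1)] and [phi_m], hence cannot improve on [G_m]. *)
Lemma norming_residual_approximant F m :
  norming F (f - G m) -> f - G m != 0 -> F (G m) = 0.
Proof.
case: m => [|m] Fm fm; first by rewrite realG.1 linear0.
apply: norming_orthogonal Fm fm _ => // l.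
have := WGAFR_best m ((1 - l) * lam m.+1) (1 - (1 - l) * (1 - w m.+1)).
have [_ /(_ m.+1 isT)[_ _ _ GE]] := realG.
rewrite subKr -!scalerA -scalerDr -GE.
by rewrite scalerBl scale1r opprB addrA addrAC.
Qed.

Lemma dict_norm_ge F x g : norming F x -> D g -> rnorm (F g) <= dict_norm D F.
Proof.
move=> Fx Dg; apply: ub_le_sup; last by exists g.
exists 1 => _ [h Dh <-].
by rewrite (le_trans (norming_le _ Fx))// dictD.1.
Qed.

(** The bound [b] is uniform in [F]: one approximation [sum_i c_i g_i] of [f]
    within [a / 2] gives [a / 2 <= |F (sum_i c_i g_i)| <= S dict_norm D F],
    with [S = sum_i |c_i|], for all the [F] considered. *)
Lemma dict_norm_lower (a : R) : 0 < a -> exists2 b : R, 0 < b &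
  forall F x, norming F x -> a <= rnorm (F f) -> b <= dict_norm D F.
Proof.
move=> a0; have : closure (lin_span D) f by rewrite dictD.2.
have a2 : 0 < (a / 2)%:C :> R[i] by rewrite ltcR divr_gt0.
move=> /(_ _ (nbhsx_ballx f _ a2))[_ [[n [c [g [Dg ->]]]]]].
rewrite -ball_normE/= -rnormE ltcR => fh.
pose S := \sum_(i < n) rnorm (c i : R[i]^o).
have S0 : 0 <= S by apply: sumr_ge0 => i _; exact: rnorm_ge0.
(* [S + 1] rather than [S], which vanishes for the empty combination. *)
exists (a / (2 * (S + 1))) => [|F x Fx aF].
  by rewrite divr_gt0// mulr_gt0// ltr_wpDl.
have FS : rnorm (F (\sum_(i < n) c i *: g i)) <= S * dict_norm D F.
  rewrite linear_sum (le_trans (rnorm_sum _))// mulr_suml ler_sum// => i _.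
  by rewrite linearZ/= rnormZ ler_wpM2l ?rnorm_ge0// (dict_norm_ge Fx).
have := le_lt_trans (norming_le (f - \sum_(i < n) c i *: g i) Fx) fh.
rewrite linearB/= => h.
have := ler_rnormD (F f - F (\sum_(i < n) c i *: g i))
  (F (\sum_(i < n) c i *: g i)).
rewrite subrK => h'.
have Sd : a / 2 <= S * dict_norm D F by lra.
have d0 : 0 < dict_norm D F.
  by rewrite ltNge; apply/negP => /(ler_wpM2l S0); rewrite mulr0; lra.
rewrite ler_pdivrMr; first lra.
by rewrite mulr_gt0// ltr_wpDl.
Qed.

(** One step with [w = 0] and step length [a v]: the gain is at least
    [a v b t_(m+1)] and the error at most [2 a v s(v)], which the choice of [v]
    makes equal to half of it. *)
Lemma WGAFR_step (a b v : R) m : 0 < a -> 0 < b ->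
  (forall F x, norming F x -> a <= rnorm (F f) -> b <= dict_norm D F) ->
  a <= rnorm (f - G m) -> 0 <= t m.+1 -> 0 <= v ->
  smooth_s X v = b / 4 * t m.+1 ->
  rnorm (f - G m.+1) <= rnorm (f - G m) - a * b / 2 * (t m.+1 * v).
Proof.
move=> a0 b0 hb am t0; rewrite le_eqVlt => /predU1P[<- _|v0].
  by rewrite !mulr0 subr0 WGAFR_residual_le.
rewrite smooth_s_gt0E// => /(canRL (divfK (lt0r_neq0 v0))) rv.
have nx : 0 < rnorm (f - G m) by exact: lt_le_trans am.
have x0 : f - G m != 0 by rewrite -rnorm_gt0.
have [_ /(_ m.+1 isT)[Dphi /=/(_ x0)[F [Fx Fphi]] _ _]] := realG.
have Ff : F f = `|f - G m|.
  have [_ _ <-] := Fx.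
  by rewrite linearB/= (norming_residual_approximant Fx x0) subr0.
have bF : b <= dict_norm D F by apply: (hb _ _ Fx); rewrite Ff /rnorm normr_id.
have bFphi : t m.+1 * b <= rnorm (F (phi m.+1)).
  by apply: le_trans Fphi; exact: ler_wpM2l.
have av0 : 0 <= a * v by rewrite mulr_ge0// ltW.
have [l hl] := norming_descent (phi m.+1) Fx x0 av0.
have := WGAFR_best m (- l) 0.
rewrite subr0 scale1r scaleNr opprD opprK addrA => /le_trans/(_ hl) h.
apply: (le_trans h).
set u := a * v * rnorm (phi m.+1) / rnorm (f - G m).
have u0 : 0 <= u by rewrite divr_ge0 ?(mulr_ge0 av0) ?rnorm_ge0.
have uv : u <= v * (a / rnorm (f - G m)).
  rewrite /u mulrA (mulrC v) ler_pM2r ?invr_gt0//.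
  by rewrite -[leRHS]mulr1 ler_wpM2l// dictD.1.
have uv' : u <= v.
  by rewrite (le_trans uv)// -[leRHS]mulr1 ler_pM2l// ler_pdivrMr ?mul1r.
have ntX : exists e : X, e != 0 by exists (f - G m).
have := modulus_convex0 ntX u0 uv' v0.
have : u / v * rho v <= a / rnorm (f - G m) * rho v.
  rewrite ler_wpM2r ?modulus_ge0//.
  by rewrite ler_pdivrMr// mulrC.
rewrite rv => h1 h2; have {h2} := le_trans h2 h1.
rewrite -(ler_pM2l (mulr_gt0 (ltr0n _ 2) nx)).
have -> : 2 * rnorm (f - G m) * (a / rnorm (f - G m) * (b / 4 * t m.+1 * v)) =
  a * b / 2 * (t m.+1 * v) by field; rewrite gt_eqF.
have := ler_wpM2l av0 bFphi.
move: (rho _) => q; lra.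
Qed.

End Algorithm.

Theorem theorem3p1 (R : realType) (X : completeNormedModType R[i])
    (D : set X) (t : nat -> R) :
  uniformly_smooth X ->
  dictionary D ->
  (forall m, (1 <= m)%N -> 0 <= t m <= 1) ->
  (forall theta : R, 0 < theta ->
    (\sum_(1 <= m <oo) (t m)%:E * smooth_s_inv X (theta * t m) = +oo)%E) ->
  forall (f : X) (phi : nat -> X) (w lam : nat -> R[i]) (G : nat -> X),
    WGAFR_realization t D f phi w lam G ->
    (fun m => rnorm (f - G m)) @ \oo --> (0 : R).
Proof.
move=> smX dictD t01 div f phi w lam G realG.
pose e m := rnorm (f - G m); rewrite -/e.
have edec : {homo e : m n / (m <= n)%N >-> n <= m}.
  by apply/nonincreasing_seqP => m; exact: WGAFR_residual_le realG m.
have [[a a0 ae]|] := pselect (exists2 a : R, 0 < a & forall m, a <= e m);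
    last first.
  move=> /forall2NP h; apply/cvgrPdist_lt => d d0.
  have [/(_ d0)//|/existsNP[N /negP]] := h d.
  rewrite -ltNge => eN; exists N => // m /= Nm.
  by rewrite sub0r normrN ger0_norm ?rnorm_ge0// (le_lt_trans (edec _ _ Nm)).
exfalso.
have [b0 b0_gt0 hb0] := dict_norm_lower f dictD a0.
(* With [b <= 2] all [b / 4 * t m] lie in [[0, 1/2]], hence in the range of [s]. *)
pose b := Num.min b0 2.
have b_gt0 : 0 < b by rewrite lt_min b0_gt0/=.
have hb F x : norming F x -> a <= rnorm (F f) -> b <= dict_norm D F.
  by move=> Fx aF; rewrite ge_min (hb0 _ _ Fx aF).
have ntX : exists y : X, y != 0.
  by exists (f - G 0%N); rewrite -rnorm_gt0 (lt_le_trans a0)// (ae 0).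
have step m : exists2 v : R, smooth_s_inv X (b / 4 * t m.+1) = v%:E &
    0 <= v /\ e m.+1 <= e m - a * b / 2 * (t m.+1 * v).
  have /andP[t0 t1] := t01 m.+1 isT.
  have bt : 0 <= b / 4 * t m.+1 <= 1 / 2.
    rewrite mulr_ge0 ?divr_ge0 ?(ltW b_gt0)//=.
    have b2 : b <= 2 by rewrite ge_min lexx orbT.
    by rewrite -[leRHS]mulr1 ler_pM ?divr_ge0 ?(ltW b_gt0)//; lra.
  have [v vE [v0 sv]] := smooth_s_invE ntX smX bt.
  exists v => //; split => //.
  exact: (WGAFR_step smX dictD realG a0 b_gt0 hb (ae m)).
have := div (b / 4) (divr_gt0 b_gt0 (ltr0n _ 4)).
set S := (X in X = _ -> _) => Soo.
suff : (S <= (e 0%N / (a * b / 2))%:E)%E by rewrite Soo leye_eq.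
have k0 : 0 < a * b / 2 by rewrite divr_gt0// mulr_gt0.
apply: lime_le.
  apply: is_cvg_nneseries => -[//|m] _ _.
  have [v -> [v0 _]] := step m; have /andP[t0 _] := t01 m.+1 isT.
  by rewrite -EFinM lee_fin mulr_ge0.
have part n : (\sum_(1 <= m < n.+1) (t m)%:E * smooth_s_inv X (b / 4 * t m)
    <= ((e 0%N - e n) / (a * b / 2))%:E)%E.
  elim: n => [|n IH]; first by rewrite big_geq// subrr mul0r.
  rewrite big_nat_recr//=; have [v -> [v0 le]] := step n.
  rewrite -EFinM (le_trans (leeD2r _ IH))// -EFinD lee_fin -lerBrDl -mulrBl.
  by rewrite ler_pdivlMr// mulrC; lra.
exists 1%N => // -[//|n] _ /=; apply: (le_trans (part n)).
by rewrite lee_fin ler_pM2r ?invr_gt0// gerBl rnorm_ge0.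
Qed.
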